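(* In the setting of the context (a weighted genus two admissible cover over the standard log point, with real-metrised tropicalisation $\Gamma$ and associated function $\lambda$), every connected component $\Omega$ of $\Delta^\circ=\{\lambda>0\}$ has positive genus.
   Context: *Admissible cover.* Over $\mathbb C$, let $\psi\colon(C,D_R)\to(T,D_B)$ be a hyperelliptic admissible cover: a finite degree two morphism of nodal curves, $C$ connected of arithmetic genus $2$, $T$ of genus $0$, étale on $C^{sm}\setminus D_R$, simply ramified along the six smooth points $D_R$ mapping to six distinct smooth points $D_B$, mapping nodes to nodes with the same ramification order $1$ or $2$ on both branches. It carries a weight $w\colon V(\Gamma)\to\mathbb N$ on the dual graph of $C$, not identically zero, such that with $w_T(v)=\sum_{v'\mapsto v}w(v')$ every component of $T$ with $w_T=0$ has at least three nodes or branch points. *Metric.* $\Gamma=\mathrm{trop}(C)$ and the tree $\Gamma_T=\mathrm{trop}(T)$ are the dual graphs with positive real edge lengths, where the length of an edge of $\Gamma_T$ is the ramification order (expansion factor) times the length of any edge of $\Gamma$ above it; $\mathrm{trop}(\psi)\colon\Gamma\to\Gamma_T$ is the induced harmonic map of degree two. For a subcurve, genus means arithmetic genus: first Betti number plus sum of vertex genera. *Functions.* A piecewise linear (PL) function has integral slopes on (a subdivision of) $\Gamma$ (half-integral slopes allowed on $\Gamma_T$); $\mathrm{div}(\lambda)(v)$ is the sum of outgoing slopes at $v$; $K_\Gamma(v)=2g(v)-2+\mathrm{val}(v)$. Pullback along $\mathrm{trop}(\psi)$ composes functions and multiplies divisors by local degrees. On $\Gamma_T$ let $D'(v)=\mathrm{val}(v)-2+\tfrac12\deg(D_B|_v)$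 (valence counts edges only); it has degree $1$ and pulls back to $K_\Gamma$. For each vertex $v_0$ of $\Gamma_T$ there is a PL function $\overline\lambda_T$, unique up to constants, with $D'+\mathrm{div}(\overline\lambda_T)=v_0$; its pullback to $\Gamma$ is an *admissible function*. Let $\overline\lambda_1,\dots,\overline\lambda_s$ be all of them and let $\lambda_i$ be $\overline\lambda_i$ shifted by a constant so that vertices with $\lambda_i>0$ have weight $0$ while those with $\lambda_i\ge0$ have total weight $\ge1$ (i.e. the maximum of $\lambda_i$ on vertices of positive weight is $0$). Define $\lambda=\max\{0,\lambda_1,\dots,\lambda_s\}$, a PL function on a subdivision of $\Gamma$, pulled back from $\lambda_T$ on $\Gamma_T$. Put $\Delta^\circ=\{\lambda>0\}$ and let $\Delta$ be the minimal subcurve of genus two containing the closure of $\Delta^\circ$, $\Delta_T$ its image in $\Gamma_T$. With $D'$ computed using valences in $\Delta_T$, $D=D'+\mathrm{div}(\lambda_T)$ is an effective divisor of degree $1$ on $\Delta_T$ and $\mathrm{trop}(\psi)^*D=K_\Delta+\mathrm{div}(\lambda)$ on $\Delta$. *)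

(* Defs.v *)
From HB Require Import structures.
From mathcomp Require Import all_boot all_order all_algebra.
From mathcomp Require Import all_classical all_reals all_analysis.
Set Implicit Arguments.
Unset Strict Implicit.
Unset Printing Implicit Defensive.
Import Order.TTheory GRing.Theory Num.Theory.
Import numFieldNormedType.Exports.
Local Open Scope classical_set_scope.
Local Open Scope ring_scope.

(* The dual graph of a complex nodal curve, with edge lengths: vertices are
   irreducible components (of geometric genus [vgenus]), edges are nodes.
   Each edge has an arbitrary reference orientation, from [ends e false] to
   [ends e true]. *)
Record tcurve (R : realType) := TCurve {
  vert : finType;
  edge : finType;
  ends : edge -> bool -> vert;
  elen : edge -> R;
  elen_gt0 : forall e, 0 < elen e;
  vgenus : vert -> nat
}.

Section MetricGraph.
Variables (R : realType) (G : tcurve R).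

(* An oriented edge [(e, b)] starts at [ends e b]; it is also the branch of the
   node [e] lying on the component [ends e b]. *)
Definition dart : Type := (edge G * bool)%type.
Definition dorig (d : dart) : vert G := ends d.1 d.2.
Definition valence (v : vert G) : nat := #|[pred d : dart | dorig d == v]|.

(* A point of the metric graph is a vertex, or a point in the interior of an
   edge [e] at distance [t] from [ends e false]. *)
Definition gpoint : Type :=
  (vert G + {p : edge G * R | 0 < p.2 < elen p.1})%type.

Definition vpt (v : vert G) : gpoint := inl v.

Definition ept (e : edge G) (t : R) : gpoint :=
  match insub (e, t) : option {p : edge G * R | 0 < p.2 < elen p.1} with
  | Some p => inr p
  | None => inl (ends e (0 < t))
  end.

(* The point of the edge [d.1] at distance [t] from [dorig d]. *)
Definition walk (d : dart) (t : R) : gpoint :=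
  ept d.1 (if d.2 then elen d.1 - t else t).

(* The tangent directions of the graph are the pairs [(d, s)] with
   [0 <= s < elen d.1]: the direction of [d] at the point [walk d s].
   A set is open if it is a neighbourhood of each of its points in every
   direction; as graphs are finite, this is the topology of the path metric. *)
Definition graph_open (U : set gpoint) : Prop :=
  forall (d : dart) (s : R), 0 <= s < elen d.1 -> U (walk d s) ->
    \forall t \near s^'+, U (walk d t).

Lemma graph_openT : graph_open setT.
Proof. by move=> d s _ _; apply: nearW. Qed.

Lemma graph_openI : setI_closed graph_open.
Proof.
move=> A B oA oB d s hs [As Bs].
by apply: filterS2 (oA d s hs As) (oB d s hs Bs) => t; split.
Qed.

Lemma graph_open_bigcup (I : Type) (f : I -> set gpoint) :
  (forall i, graph_open (f i)) -> graph_open (\bigcup_i f i).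
Proof.
move=> of_ d s hs [i _ fis].
by apply: filterS (of_ i d s hs fis) => t fit; exists i.
Qed.

HB.instance Definition _ := Choice.on gpoint.
HB.instance Definition _ :=
  isOpenTopological.Build gpoint graph_openT graph_openI graph_open_bigcup.

(* [f] has slope [k] in the tangent direction [(d, s)]. *)
Definition has_slope (f : gpoint -> R) (d : dart) (s k : R) : Prop :=
  \forall t \near s^'+, f (walk d t) = f (walk d s) + k * (t - s).

Definition slope (f : gpoint -> R) (d : dart) (s : R) : R :=
  xget 0 [set k | has_slope f d s k].

(* Piecewise linear functions with slopes in (1/n)Z.  Being affine near every
   point in every tangent direction, such an [f] is continuous and, edges being
   compact, has finitely many pieces on each of them. *)
Definition PL (n : nat) (f : gpoint -> R) : Prop :=
  forall (d : dart) (s : R), 0 <= s < elen d.1 ->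
    exists2 k, has_slope f d s k & n%:R * k \is a Num.int.

Definition divf (f : gpoint -> R) (x : gpoint) : R :=
  match x with
  | inl v => \sum_(d : dart | dorig d == v) slope f d 0
  | inr p => let: (e, t) := sval p in
             slope f (e, false) t + slope f (e, true) (elen e - t)
  end.

Definition edges_in (A : set gpoint) : {set edge G} :=
  [set e | `[< forall t, 0 <= t <= elen e -> A (ept e t) >]].

(* First Betti number: the dimension of the space of rational 1-cycles on the
   closed edges contained in [A].  For [A] open or a subgraph, the rest of [A]
   retracts onto its vertices and full edges, up to contractible pieces. *)
Definition betti1 (A : set gpoint) : nat :=
  let bd := \matrix_(i < #|edges_in A|, j < #|vert G|)
    let e := enum_val i in let v := enum_val j in
    (ends e true == v)%:R - (ends e false == v)%:R : rat in
  \rank (kermx bd).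

Definition genus (A : set gpoint) : nat :=
  (betti1 A + \sum_(v : vert G | `[< A (vpt v) >]) vgenus v)%N.

End MetricGraph.

(* The combinatorial data of a hyperelliptic admissible cover psi : C -> T.
   Reference orientations on [graphC] are those pulled back from [graphT];
   [ramord] is the ramification order at a node (the expansion factor of the
   edge), [vdeg] the degree of psi on a component over its image, and the six
   points of D_B and D_R are recorded by the components containing them. *)
Record hyp_cover (R : realType) := HypCover {
  graphC : tcurve R;
  graphT : tcurve R;
  psiV : vert graphC -> vert graphT;
  psiE : edge graphC -> edge graphT;
  vdeg : vert graphC -> nat;
  ramord : edge graphC -> nat;
  ramC : 'I_6 -> vert graphC;
  branchT : 'I_6 -> vert graphT;
  wt : vert graphC -> nat;
  graphC_connected : connected [set: gpoint graphC];
  graphC_genus : genus [set: gpoint graphC] = 2%N;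
  graphT_connected : connected [set: gpoint graphT];
  graphT_genus : genus [set: gpoint graphT] = 0%N;
  psi_ends : forall e b, ends (psiE e) b = psiV (ends e b);
  ramord12 : forall e, ramord e = 1%N \/ ramord e = 2%N;
  psi_elen : forall e, elen (psiE e) = (ramord e)%:R * elen e;
  vdeg_gt0 : forall v, (0 < vdeg v)%N;
  psi_degree : forall v', (\sum_(v | psiV v == v') vdeg v = 2)%N;
  (* the fibre over a branch of a node of T has the degree of the component *)
  psi_harmonic : forall (v : vert graphC) (d' : dart graphT),
    dorig d' = psiV v ->
    (\sum_(e | (psiE e == d'.1) && (ends e d'.2 == v)) ramord e = vdeg v)%N;
  psi_ram : forall i, psiV (ramC i) = branchT i;
  (* ramification of order two at the points of D_R *)
  vdeg_ram : forall i, vdeg (ramC i) = 2%N;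
  (* psi is ramified on the component [v] only at D_R (simply) and at nodes:
     Riemann-Hurwitz for the restriction of psi to the component *)
  riemann_hurwitz : forall v : vert graphC,
    2 * (vgenus v)%:Z - 2 =
      (vdeg v)%:Z * (2 * (vgenus (psiV v))%:Z - 2)
      + #|[pred i | ramC i == v]|%:Z
      + \sum_(d : dart graphC | dorig d == v) ((ramord d.1)%:Z - 1);
  wt_neq0 : exists v, wt v <> 0%N;
  wt_stable : forall v' : vert graphT,
    (\sum_(v | psiV v == v') wt v = 0)%N ->
    (3 <= valence v' + #|[pred i | branchT i == v']|)%N
}.

Section Admissible.
Variables (R : realType) (C : hyp_cover R).
Local Notation GC := (graphC C).
Local Notation GT := (graphT C).

Definition trop (x : gpoint GC) : gpoint GT :=
  match x with
  | inl v => vpt (psiV v)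
  | inr p => let: (e, t) := sval p in ept (psiE e) ((ramord e)%:R * t)
  end.

(* The divisor D' on the tree, extended by 0 outside the vertices. *)
Definition Dprime (x : gpoint GT) : R :=
  match x with
  | inl v =>
      (valence v)%:R - 2 + 2^-1 * #|[pred i : 'I_6 | branchT C i == v]|%:R
  | inr _ => 0
  end.

Definition is_lambdabarT (v0 : vert GT) (f : gpoint GT -> R) : Prop :=
  PL 2 f /\ forall x, Dprime x + divf f x = (x == vpt v0)%:R.

Definition normalized (f : gpoint GC -> R) : Prop :=
  (forall v, 0 < f (vpt v) -> wt v = 0%N) /\
  (1 <= \sum_(v : vert GC | (0 <= f (vpt v))%R) wt v)%N.

(* [f] is the pullback of a solution for [v0], shifted so that its maximum on
   the vertices of positive weight is 0. *)
Definition is_lambda (v0 : vert GT) (f : gpoint GC -> R) : Prop :=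
  exists (fT : gpoint GT -> R) (c : R),
    [/\ is_lambdabarT v0 fT, f = (fun x => fT (trop x) + c) & normalized f].

Definition lambda_max (lam : vert GT -> gpoint GC -> R) (x : gpoint GC) : R :=
  \big[Num.max/0]_(v0 : vert GT) lam v0 x.

Definition Delta_open (lam : vert GT -> gpoint GC -> R) : set (gpoint GC) :=
  [set x | 0 < lambda_max lam x].

End Admissible.

(* Main.v *)
(** Write [lambda_i] for the functions [lam v0].  Each of them is affine on every
    edge, and [K + div lambda_i] is effective because [K] is the pullback of [D'].
    Its slopes are integral: removing from the tree the image of an unramified
    edge, the number of branch points on either side is even by
    Riemann-Hurwitz.
    Let [Omega] be a component of [lambda > 0] and assume that it has genus zero.
    It contains a vertex [v], so having no cycles it contains fewer edges than
    vertices.  For each such [v] choose [i(v)] with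
    [lambda_i(v) (v) = lambda v].  Summing [K + div lambda_i(v) >= 0] over the
    vertices of [Omega], a pair of opposite directions along an edge inside
    [Omega] contributes at most 2 (the slopes add up to at most 0 by
    maximality), and a direction whose edge leaves [Omega] contributes at most 0
    (its slope is negative, hence at most -1).  So [0 <= 2 E - 2 V < 0]. *)
Require Import Defs.
From mathcomp Require Import all_boot all_order all_algebra.
From mathcomp Require Import all_classical all_reals all_analysis.
From mathcomp Require Import ring lra.
Import Order.TTheory GRing.Theory Num.Theory.
Import numFieldNormedType.Exports.
Local Open Scope classical_set_scope.
Local Open Scope ring_scope.
Set Implicit Arguments.
Unset Strict Implicit.
Unset Printing Implicit Defensive.

Lemma near_reflect (R : realType) (L t : R) (P : R -> Prop) :
  (\forall u \near (L - t)^'+, P (L - u)) -> \forall s \near t^'-, P s.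
Proof.
move=> /nbhs_right0P h; apply/nbhs_left0P.
by apply: filterS h => u; rewrite (_ : L - (L - t + u) = t - u)//; ring.
Qed.

Lemma real_induction (R : realType) (a b : R) (P : R -> Prop) :
    (forall s, a <= s <= b -> (forall t, a <= t < s -> P t) -> P s) ->
    (forall s, a <= s < b -> (forall t, a <= t <= s -> P t) ->
       \forall t \near s^'+, P t) ->
  forall s, a <= s <= b -> P s.
Proof.
move=> closedP openP; apply: contrapT => /existsNP[s0 /not_implyP[s0ab nPs0]].
pose B := [set s | a <= s <= b /\ ~ P s].
have infB : has_inf B.
  by split; [exists s0|exists a => s [] /andP[]].
set m := inf B.
have mlow s : a <= s < m -> P s.
  move=> /andP[as_ sm]; apply: contrapT => nPs.
  have : m <= s; last by rewrite leNgt sm.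
  apply: ge_inf; first exact: infB.2.
  split => //; rewrite as_ (le_trans (ltW sm))//.
  apply: (le_trans (ge_inf infB.2 _)); first by split; [exact: s0ab|].
  by case/andP: s0ab.
have mab : a <= m <= b.
  apply/andP; split.
    by apply: lb_le_inf => [|s [/andP[]]//]; exact: infB.1.
  apply: (le_trans (ge_inf infB.2 _)); first by split; [exact: s0ab|].
  by case/andP: s0ab.
have Pm : P m by apply: closedP.
have Ple t : a <= t <= m -> P t.
  by move=> /andP[at_]; rewrite le_eqVlt => /predU1P[->//|tm]; apply: mlow; rewrite at_.
have [mb|bm] := ltP m b; last first.
  apply: nPs0; apply: Ple; case/andP: s0ab => -> /= h; exact: le_trans bm.
have /openP : a <= m < b by case/andP: mab => ->.
move=> /(_ Ple) /nbhs_right0P.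
move=> [/= r r0 hr].
have [s [/andP[as_ sb] nPs] sm] := @inf_adherent _ B r r0 infB.
have ms : m <= s by apply: ge_inf; [exact: infB.2|split; rewrite ?as_].
apply: nPs; move: ms; rewrite le_eqVlt => /predU1P[<-//|ms].
rewrite -(subrK m s) addrC; apply: hr; last by rewrite subr_gt0.
by rewrite /= distrC subr0 gtr0_norm ?subr_gt0// ltrBlDl.
Qed.

Section EdgeParametrization.
Variables (R : realType) (G : tcurve R).
Implicit Types (e : edge G) (f : gpoint G -> R).

Lemma ept_le0 e t : t <= 0 -> ept e t = vpt (ends e false).
Proof.
move=> t0; rewrite /ept insubF; last by rewrite /= ltNge t0.
by rewrite ltNge t0.
Qed.

Lemma ept_ge e t : elen e <= t -> ept e t = vpt (ends e true).
Proof.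
move=> t1; rewrite /ept insubF; last by rewrite /= [t < _]ltNge t1 andbF.
by rewrite (lt_le_trans (elen_gt0 e) t1).
Qed.

Lemma ept_inner e t (h : 0 < t < elen e) :
  ept e t = inr (exist (fun p : edge G * R => 0 < p.2 < elen p.1) (e, t) h).
Proof.
rewrite /ept; case: insubP => [p hp vp|]; last by rewrite h.
by congr inr; apply: val_inj.
Qed.

Lemma continuous_ept e : continuous (ept e).
Proof.
have L0 := elen_gt0 e.
move=> t; apply/left_right_continuousP.
split=> U; rewrite nbhsE => -[V [oV Vt] VU].
- have [t0|t0] := leP t 0.
    apply: filterS (nbhs_left_lt t) => s st; apply: VU => /=.
    by rewrite ept_le0 -1?(ept_le0 e t0)// ltW// (lt_le_trans st).
  have [Lt|tL] := ltP (elen e) t.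
    apply: filterS (nbhs_left_gt Lt) => s Ls; apply: VU => /=.
    by rewrite ept_ge ?(ltW Ls)// -(ept_ge (ltW Lt)).
  have h : 0 <= elen e - t < elen e by rewrite subr_ge0 tL/= ltrBlDr ltrDl.
  have /= := oV (e, true) _ h; rewrite /walk /= subKr => /(_ Vt) nV.
  by apply: (@near_reflect _ (elen e)); apply: filterS nV => u; exact: VU.
- have [t0|t0] := ltP t 0.
    apply: filterS (nbhs_right_lt t0) => s st; apply: VU => /=.
    by rewrite ept_le0 ?(ltW st)// -(ept_le0 e (ltW t0)).
  have [Lt|tL] := leP (elen e) t.
    apply: filterS (nbhs_right_gt t) => s Ls; apply: VU => /=.
    by rewrite ept_ge -1?(ept_ge Lt)// (le_trans Lt) ?ltW.
  have h : 0 <= t < elen e by rewrite t0.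
  by apply: filterS (oV (e, false) _ h Vt) => u; exact: VU.
Qed.

Lemma component_segment (A : set (gpoint G)) x e (a b s : R) :
    (forall t, a <= t <= b -> A (ept e t)) -> a <= s <= b ->
    connected_component A x (ept e s) ->
  forall t, a <= t <= b -> connected_component A x (ept e t).
Proof.
move=> Aab sab xs t tab.
apply: connected_component_trans xs _.
have cI : connected (ept e @` `[a, b]).
  apply: connected_continuous_connected; first exact: segment_connected.
  by apply: continuous_subspaceT; exact: continuous_ept.
apply: (connected_component_max _ _ cI).
- by exists s => //=; rewrite in_itv.
- by move=> _ [u /= + <-]; rewrite in_itv; exact: Aab.
- by exists t => //=; rewrite in_itv.
Qed.

Lemma has_slope_uniq f d s k l : has_slope f d s k -> has_slope f d s l -> k = l.
Proof.
move=> hk hl.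
have [t [[tk tl] st]] := @filter_ex _ s^'+ _ _
  (filterI (filterI hk hl) (nbhs_right_gt s)).
by move: tl; rewrite tk => /addrI /mulIf; apply; rewrite subr_eq0 gt_eqF.
Qed.

Lemma slopeE f d s k : has_slope f d s k -> slope f d s = k.
Proof.
by move=> hk; apply: xget_unique => // l hl; exact: has_slope_uniq hl hk.
Qed.

Lemma PL_affine n f e : PL n f ->
    (forall t, 0 < t < elen e -> divf f (ept e t) = 0) ->
  exists2 k : R, n%:R * k \is a Num.int &
    [/\ forall t, 0 <= t <= elen e ->
          f (ept e t) = f (vpt (ends e false)) + k * t,
        slope f (e, false) 0 = k & slope f (e, true) 0 = - k].
Proof.
move=> plf divf0; have L0 := elen_gt0 e.
have hL : (0 : R) <= 0 < elen e by rewrite lexx.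
have [k hk nk] := plf (e, false) 0 hL; exists k => //.
have left_slope s : 0 < s <= elen e ->
    (forall t, 0 <= t < s -> f (ept e t) = f (vpt (ends e false)) + k * t) ->
    has_slope f (e, true) (elen e - s) (- k) /\
    f (ept e s) = f (vpt (ends e false)) + k * s.
  move=> /andP[s0 sL] hs.
  have h : 0 <= elen e - s < elen e by rewrite subr_ge0 sL/= ltrBlDr ltrDl.
  have [k2 hk2 _] := plf (e, true) _ h.
  have near_s : \forall u \near s^'-, f (ept e u) = f (ept e s) + k2 * (s - u).
    apply: (@near_reflect _ (elen e)).
    move: hk2; rewrite /has_slope /walk /= subKr; apply: filterS => u ->.
    by congr (_ + _ * _); ring.
  have near_lt : \forall u \near s^'-, 0 < u < s.
    by apply: filterS2 (nbhs_left_gt s0) (nbhs_left_lt s) => u -> ->.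
  have [u [ueq /andP[u0 us]]] := @filter_ex _ s^'- _ _ (filterI near_s near_lt).
  have near_u : \forall v \near s^'-, u < v < s.
    by apply: filterS2 (nbhs_left_gt us) (nbhs_left_lt s) => v -> ->.
  have [v [veq /andP[uv vs]]] := @filter_ex _ s^'- _ _ (filterI near_s near_u).
  rewrite hs ?(ltW u0)// in ueq.
  rewrite hs ?(ltW (lt_trans u0 uv))// in veq.
  have k2E : k2 = - k.
    have : (k + k2) * (v - u) = 0 by nra.
    by move/eqP; rewrite mulf_eq0 subr_eq0 (gt_eqF uv) orbF => /eqP; lra.
  by rewrite -k2E; split => //; move: ueq; rewrite k2E; nra.
have aff s : 0 <= s <= elen e -> f (ept e s) = f (vpt (ends e false)) + k * s.
  move: s; apply: real_induction => s /andP[s0 sL] hs.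
    move: s0; rewrite le_eqVlt => /predU1P[<-|s0].
      by rewrite ept_le0// mulr0 addr0.
    by apply: (left_slope s _ hs).2; rewrite s0.
  have h : 0 <= s < elen e by rewrite s0.
  have [k1 hk1 _] := plf (e, false) s h.
  suff k1E : k1 = k.
    move: hk1; rewrite /has_slope /walk /= (hs s) ?s0 ?lexx// k1E.
    by apply: filterS => t ->; ring.
  move: (s0); rewrite le_eqVlt => /predU1P[s0'|s0'].
    by move: hk1; rewrite -s0' => hk1; exact: has_slope_uniq hk1 hk.
  have hs' : 0 < s < elen e by rewrite s0'.
  have [||lk _] := left_slope s; first by rewrite s0' (ltW sL).
    by move=> t /andP[t0 ts]; apply: hs; rewrite t0 ltW.
  have := divf0 s hs'; rewrite (ept_inner hs') /= (slopeE hk1) (slopeE lk).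
  by lra.
split => //; first exact: slopeE.
have [||+ _] := left_slope (elen e); first by rewrite L0 lexx.
  by move=> t /andP[t0 tL]; apply: aff; rewrite t0 ltW.
by rewrite subrr => /slopeE.
Qed.

End EdgeParametrization.

Section Forest.
Variables (R : realType) (G : tcurve R).
Implicit Types (e : edge G) (A : set (gpoint G)).

Definition incidence e (v : vert G) : rat :=
  (ends e true == v)%:R - (ends e false == v)%:R.

Lemma betti1_eq0 A : betti1 A = 0%N ->
  row_free (\matrix_(i < #|edges_in A|, j < #|vert G|)
    incidence (enum_val i) (enum_val j)).
Proof. by move=> /eqP; rewrite mxrank_eq0 kermx_eq0. Qed.

(* A right inverse of the incidence matrix yields a function on vertices that
   jumps by 1 along [e] and is constant along all the other edges. *)
Lemma forest_cut A e : betti1 A = 0%N -> e \in edges_in A ->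
  exists S : {set vert G}, forall e', e' \in edges_in A ->
    (ends e' true \in S) = (ends e' false \in S) (+) (e' == e).
Proof.
move=> /betti1_eq0/row_freeP[B bdB] eA.
pose u v : rat := B (enum_rank v) (enum_rank_in eA e).
have uE e' : e' \in edges_in A -> u (ends e' true) - u (ends e' false) = (e' == e)%:R.
  move=> e'A; have /matrixP/(_ (enum_rank_in eA e') (enum_rank_in eA e)) := bdB.
  rewrite !mxE -(inj_eq enum_val_inj) !enum_rankK_in// => <-.
  rewrite (reindex enum_rank) /=; last by exists enum_val => ? _; rewrite (enum_valK, enum_rankK).
  under eq_bigr do rewrite !mxE enum_rankK_in// enum_rankK mulrBl.
  rewrite big_split sumrN /=; congr (_ - _).
    rewrite (bigD1 (ends e' true))//= eqxx mul1r big1 ?addr0// => v vN.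
    by rewrite eq_sym (negPf vN) mul0r.
  rewrite (bigD1 (ends e' false))//= eqxx mul1r big1 ?addr0// => v vN.
  by rewrite eq_sym (negPf vN) mul0r.
exists [set v | u v == u (ends e true)]%SET => e' e'A; rewrite !inE.
have := uE e' e'A; case: eqVneq => [->|ne] /=.
  move=> h; rewrite eqxx.
  have /negPf-> // : u (ends e false) != u (ends e true).
  by apply: contra_eq_neq h => ->; rewrite subrr.
by move=> /eqP; rewrite subr_eq0 => /eqP ->; rewrite addbF.
Qed.

Lemma forest_card A v0 : betti1 A = 0%N -> A (vpt v0) ->
  (#|edges_in A| < #|[set v : vert G | `[< A (vpt v) >]]%SET|)%N.
Proof.
move=> /betti1_eq0/eqP bdr Av0.
set VA := [set v | _]%SET.
have v0A : v0 \in VA by rewrite inE; apply/asboolP.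
rewrite (cardsD1 v0 VA) v0A ltnS -[X in (X <= _)%N]bdr.
set W := VA :\ v0.
pose P := \matrix_(i < #|edges_in A|, j < #|W|)
  incidence (enum_val i) (enum_val j).
pose Q := \matrix_(i < #|W|, j < #|vert G|)
  ((enum_val i == enum_val j)%:R - (v0 == enum_val j)%:R : rat).
have -> : (\matrix_(i < #|edges_in A|, j < #|vert G|)
    incidence (enum_val i) (enum_val j)) = P *m Q.
  have sumW v w : v \in VA -> \sum_(i < #|W|) (v == enum_val i)%:R *
      ((enum_val i == w)%:R - (v0 == w)%:R) = (v == w)%:R - (v0 == w)%:R :> rat.
    move=> vA; rewrite -(big_enum_val (fun x => (v == x)%:R *
      ((x == w)%:R - (v0 == w)%:R))) /=.
    have [->|vv0] := eqVneq v v0.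
      rewrite subrr big1// => x; rewrite in_setD1 => /andP[xv0 _].
      by rewrite eq_sym (negPf xv0) mul0r.
    rewrite (bigD1 v) ?in_setD1 ?vv0//= eqxx mul1r big1 ?addr0//.
    by move=> x /andP[_ xv]; rewrite eq_sym (negPf xv) mul0r.
  apply/matrixP => i j; rewrite !mxE.
  under eq_bigr do rewrite !mxE mulrBl.
  have endA b : ends (enum_val i) b \in VA.
    have := enum_valP i; rewrite inE => /asboolP eiA; rewrite inE; apply/asboolP.
    have L0 := elen_gt0 (enum_val i); case: b.
      by have := eiA (elen (enum_val i)); rewrite ept_ge// lexx ltW//; apply.
    by have := eiA 0; rewrite ept_le0// lexx ltW//; apply.
  by rewrite big_split sumrN /= !sumW// /incidence; ring.
exact: mulmx_max_rank.
Qed.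

End Forest.

Section DartSums.
Variables (R : realType) (G : tcurve R).

Lemma sum_darts (S : pred (vert G)) (F : dart G -> R) :
  \sum_(v | S v) \sum_(d : dart G | dorig d == v) F d =
  \sum_e \sum_(b : bool) (S (ends e b))%:R * F (e, b).
Proof.
transitivity (\sum_(d : dart G | S (dorig d)) F d).
  rewrite [RHS](partition_big (@dorig R G) S)//=.
  apply: eq_bigr => v Sv; apply: eq_bigl => d.
  by have [->|] := eqVneq (dorig d) v; rewrite ?Sv ?andbF.
rewrite pair_big big_mkcond /=; apply: eq_bigr => -[e b] _ /=.
by rewrite /dorig /=; case: (S _); rewrite ?mul1r ?mul0r.
Qed.

End DartSums.

Section Cover.
Variables (R : realType) (C : hyp_cover R).
Local Notation GC := (graphC C).
Local Notation GT := (graphT C).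

Lemma betti1T : betti1 [set: gpoint GT] = 0%N.
Proof. by have := graphT_genus C => /eqP; rewrite addn_eq0 => /andP[/eqP]. Qed.

Lemma vgenusT (v : vert GT) : vgenus v = 0%N.
Proof.
have := graphT_genus C => /eqP; rewrite addn_eq0 sum_nat_eq0 => /andP[_].
move=> /forallP/(_ v)/implyP h; apply/eqP/h.
by apply/asboolP.
Qed.

Lemma edges_inT (e : edge GT) : e \in edges_in [set: gpoint GT].
Proof. by rewrite inE; apply/asboolP. Qed.

Lemma sum_dart_fibre (v : vert GC) (H : dart GT -> R) :
  \sum_(d : dart GC | dorig d == v) (ramord d.1)%:R * H (psiE d.1, d.2) =
  (vdeg v)%:R * \sum_(d' : dart GT | dorig d' == psiV v) H d'.
Proof.
rewrite (partition_big (fun d : dart GC => (psiE d.1, d.2) : dart GT)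
  (fun d' : dart GT => dorig d' == psiV v)) /=; last first.
  by move=> [e b] /eqP <-; rewrite /dorig /= psi_ends.
rewrite mulr_sumr; apply: eq_bigr => -[e' b'] /eqP d'v.
rewrite -(psi_harmonic d'v) natr_sum mulr_suml /=.
rewrite (reindex_onto (fun e => (e, b') : dart GC) (fun d => d.1)) /=; last first.
  by move=> [e b] /andP[_ /eqP[_ ->]].
apply: eq_big => [e|e /andP[/andP[_ /eqP[->]] _]//].
by rewrite /dorig /= eqxx andbT xpair_eqE eqxx andbT andbC.
Qed.

Lemma riemann_hurwitzR (v : vert GC) : 2 * (vgenus v)%:R - 2 =
  - 2 * (vdeg v)%:R + #|[pred i : 'I_6 | ramC C i == v]|%:R
  + \sum_(d : dart GC | dorig d == v) ((ramord d.1)%:R - 1) :> R.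
Proof.
have /(congr1 (fun z : int => z%:~R : R)) := riemann_hurwitz v.
rewrite vgenusT !(rmorphD, rmorphB, rmorphM, rmorph_sum, rmorphN) /=.
under eq_bigr do rewrite rmorphB /=.
move=> ->; ring.
Qed.

Lemma card_ram (v : vert GC) :
  (2 * #|[pred i : 'I_6 | ramC C i == v]| =
   vdeg v * #|[pred i : 'I_6 | branchT C i == psiV v]|)%N.
Proof.
have fibre i : branchT C i = psiV v -> vdeg v = 2%N /\ ramC C i = v.
  move=> biv.
  have riv : psiV (ramC C i) == psiV v by rewrite psi_ram biv.
  have := psi_degree (psiV v).
  rewrite (bigD1 (ramC C i))//= vdeg_ram => /eqP.
  rewrite -[X in _ == X]addn0 eqn_add2l sum_nat_eq0 => /forallP/(_ v).
  rewrite eqxx /= => /implyP h.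
  have [->|ne] := eqVneq v (ramC C i); first by rewrite vdeg_ram.
  by have := vdeg_gt0 v; rewrite lt0n h.
have [i /eqP biv|none] := pickP [pred i : 'I_6 | branchT C i == psiV v].
  have [-> _] := fibre i biv; congr (2 * _)%N; apply: eq_card => j.
  rewrite !inE; apply/eqP/eqP => [<-|/fibre[]//].
  by rewrite psi_ram.
rewrite (eq_card0 none) muln0 eq_card0// => i; rewrite !inE.
by apply: contraFF (none i) => /eqP <-; rewrite /= psi_ram.
Qed.

Lemma canonical_pullback (v : vert GC) :
  2 * (vgenus v)%:R - 2 + (valence v)%:R = (vdeg v)%:R * Dprime (vpt (psiV v)) :> R.
Proof.
have valE : (valence v)%:R = \sum_(d : dart GC | dorig d == v) 1 :> R.
  by rewrite sumr_const.
have valE' : (vdeg v)%:R * (valence (psiV v))%:R =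
    \sum_(d : dart GC | dorig d == v) (ramord d.1)%:R :> R.
  transitivity (\sum_(d : dart GC | dorig d == v) (ramord d.1)%:R * (fun=> 1) (psiE d.1, d.2) : R).
    by rewrite (sum_dart_fibre v (fun=> 1)) sumr_const.
  by under eq_bigr do rewrite mulr1.
have /(congr1 (fun n => n%:R : R)) := card_ram v; rewrite !natrM.
rewrite riemann_hurwitzR big_split sumrN /= -valE -valE' => ram2.
lra.
Qed.

(* Discrete form of [is_lambdabarT]: slopes [q e] along [e], on a tree. *)
Definition tree_slopes (v0 : vert GT) (q : edge GT -> R) : Prop :=
  (forall e, 2 * q e \is a Num.int) /\
  forall v, Dprime (vpt v) + \sum_(d : dart GT | dorig d == v) (-1) ^+ d.2 * q d.1
    = (v == v0)%:R.

Lemma tree_slopes_effective v0 q (v : vert GC) : tree_slopes v0 q ->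
  0 <= 2 * (vgenus v)%:R - 2 + (valence v)%:R +
    \sum_(d : dart GC | dorig d == v) (-1) ^+ d.2 * ((ramord d.1)%:R * q (psiE d.1)).
Proof.
move=> [_ hq]; rewrite canonical_pullback.
under eq_bigr do rewrite mulrCA.
rewrite (sum_dart_fibre v (fun d' => (-1) ^+ d'.2 * q d'.1)) -mulrDr hq.
by rewrite mulr_ge0.
Qed.

Lemma fibre_unramified (e e1 : edge GC) :
  ramord e = 1%N -> psiE e1 = psiE e -> ramord e1 = 1%N.
Proof.
move=> re e1e; case: (ramord12 e1) => // re1.
have [ee1|ne] := eqVneq e1 e; first by rewrite ee1 re in re1.
have /= : (\sum_(v : vert GC | psiV v == psiV (ends e false))
    \sum_(e2 | (psiE e2 == psiE e) && (ends e2 false == v)) ramord e2 = 2)%N.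
  rewrite -[RHS](psi_degree (psiV (ends e false))); apply: eq_bigr => v /eqP vE.
  by apply: (psi_harmonic (d' := (psiE e, false))); rewrite /dorig /= psi_ends vE.
have -> : (\sum_(v : vert GC | psiV v == psiV (ends e false))
    \sum_(e2 | (psiE e2 == psiE e) && (ends e2 false == v)) ramord e2 =
    \sum_(e2 | psiE e2 == psiE e) ramord e2)%N.
  rewrite [RHS](partition_big (fun e2 => ends e2 false)
    (fun v => psiV v == psiV (ends e false)))// => e2 /eqP e2e.
  by rewrite -!psi_ends e2e.
by rewrite (bigD1 e)//= (bigD1 e1) /= ?e1e ?eqxx// re re1.
Qed.

(* Cutting the tree at [psiE e], the slope is half the number of branch points
   on one side, modulo Z; by Riemann-Hurwitz over that side this number is even
   when [e] is unramified. *)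
Lemma tree_slopes_int v0 q (e : edge GC) : tree_slopes v0 q ->
  (ramord e)%:R * q (psiE e) \is a Num.int.
Proof.
move=> [qint hq]; case: (ramord12 e) => re; last by rewrite re.
rewrite re mul1r.
have [S cutS] := forest_cut betti1T (edges_inT (psiE e)).
have {}cutS e' := cutS e' (edges_inT e').
pose sgn : R := (-1) ^+ (ends (psiE e) true \in S).
have sumT : \sum_(v in S) (\sum_(d : dart GT | dorig d == v) (-1) ^+ d.2 * q d.1)
    = sgn * q (psiE e).
  rewrite sum_darts (bigD1 (psiE e))//= [X in _ + X]big1 => [|e' ne].
    rewrite !big_bool/= /sgn (cutS (psiE e)) eqxx addbT.
    by case: (_ \in _) => /=; rewrite ?expr1 ?expr0; ring.
  rewrite !big_bool/= (cutS e') (negPf ne) addbF.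
  by case: (_ \in _); rewrite /= ?expr1 ?expr0; ring.
pose B := \sum_(v in S) #|[pred i : 'I_6 | branchT C i == v]|%:R : R.
have sumD : \sum_(v in S) Dprime (vpt v) =
    \sum_(v in S) ((valence v)%:R - 2) + 2^-1 * B.
  by rewrite /B mulr_sumr -big_split.
have sum0 : \sum_(v in S) (v == v0)%:R = \sum_(v in S) Dprime (vpt v) + sgn * q (psiE e).
  by rewrite -sumT -big_split; apply: eq_bigr => v _; rewrite -hq.
suff Bint : 2^-1 * B \is a Num.int.
  have -> : q (psiE e) = sgn * (\sum_(v in S) (v == v0)%:R
      - \sum_(v in S) ((valence v)%:R - 2) - 2^-1 * B).
    have sgn2 : sgn * sgn = 1 by rewrite -expr2 sqrr_sign.
    transitivity (sgn * (sgn * q (psiE e))); first by rewrite mulrA sgn2 mul1r.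
    by rewrite sum0 sumD; congr (_ * _); ring.
  apply: rpredM; first exact: rpred_sign.
  apply: rpredB Bint; apply: rpredB; apply: rpred_sum => v _; first exact: rpred_nat.
  by rewrite rpredB ?rpred_nat.
have BE : B = \sum_(v : vert GC | psiV v \in S) #|[pred i : 'I_6 | ramC C i == v]|%:R.
  rewrite /B -!natr_sum; congr (_%:R).
  under eq_bigr do rewrite -sum1_card.
  under [RHS]eq_bigr do rewrite -sum1_card.
  transitivity (\sum_(i : 'I_6 | branchT C i \in S) 1)%N.
    rewrite [RHS](partition_big (branchT C) (mem S))//=.
    apply: eq_bigr => v vS; apply: eq_bigl => i; rewrite !inE.
    by case: eqP => [->|]; rewrite ?vS ?andbF.
  rewrite [LHS](partition_big (ramC C) (fun v => psiV v \in S)) /=; last first.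
    by move=> i; rewrite psi_ram.
  apply: eq_bigr => v vS; apply: eq_bigl => i; rewrite !inE.
  by case: eqP => [riv|]; rewrite ?andbF// -psi_ram riv vS.
have sumRH : B = \sum_(v : vert GC | psiV v \in S) (2 * (vgenus v)%:R - 2 + 2 * (vdeg v)%:R)
    - \sum_(v : vert GC | psiV v \in S) \sum_(d : dart GC | dorig d == v) ((ramord d.1)%:R - 1).
  rewrite BE -sumrB; apply: eq_bigr => v _; rewrite riemann_hurwitzR; ring.
rewrite sumRH mulrBr rpredB//.
  rewrite mulr_sumr rpred_sum// => v _.
  have -> : 2^-1 * (2 * (vgenus v)%:R - 2 + 2 * (vdeg v)%:R) =
    (vgenus v)%:R - 1 + (vdeg v)%:R :> R by lra.
  by rewrite rpredD ?rpredB ?rpred_nat ?rpred1.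
rewrite (sum_darts (fun v => psiV v \in S)) mulr_sumr rpred_sum// => e1 _.
rewrite big_bool /= -!psi_ends cutS.
have [e1e|_] := eqVneq (psiE e1) (psiE e).
  by rewrite (fibre_unramified re e1e) subrr !mulr0 addr0 mulr0.
have -> (a : bool) (r : R) : 2^-1 * ((a (+) false)%:R * (r - 1) + a%:R * (r - 1))
    = a%:R * (r - 1) by rewrite addbF; lra.
by rewrite rpredM ?rpredB ?rpred_nat ?rpred1.
Qed.

Lemma is_lambda_slopes v0 (f : gpoint GC -> R) : is_lambda v0 f ->
  exists2 q, tree_slopes v0 q & forall e t, 0 <= t <= elen e ->
    f (ept e t) = f (vpt (ends e false)) + (ramord e)%:R * q (psiE e) * t.
Proof.
move=> [fT [c [[plT divT] -> _]]] {f}.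
have affT e := PL_affine (e := e) plT.
have {}affT e : exists2 k : R, 2 * k \is a Num.int &
    [/\ forall t, 0 <= t <= elen e ->
          fT (ept e t) = fT (vpt (ends e false)) + k * t,
        slope fT (e, false) 0 = k & slope fT (e, true) 0 = - k].
  apply: affT => t h; have := divT (ept e t); rewrite (ept_inner h).
  by rewrite [Dprime _]/= add0r => ->.
exists (fun e => slope fT (e, false) 0); first split.
- by move=> e; have [k kint [_ -> _]] := affT e.
- move=> v; have := divT (vpt v) => /= <-; congr (_ + _).
  apply: eq_bigr => -[e b] _ /=; have [k _ [_ -> sk]] := affT e.
  case: b; last by rewrite expr0 mul1r; have [k' _ [_ -> sk']] := affT e; lra.
  by rewrite sk expr1 mulN1r.
- move=> e t /andP[t0 tL]; have [k _ [kaff -> _]] := affT (psiE e).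
  have r0 : 0 < (ramord e)%:R :> R by case: (ramord12 e) => ->.
  have tropE : trop (ept e t) = ept (psiE e) ((ramord e)%:R * t).
    have [t0'|t0'] := leP t 0.
      by rewrite !ept_le0 ?(mulr_ge0_le0 (ltW r0))//= psi_ends.
    have [Lt|Lt] := leP (elen e) t.
      by rewrite !ept_ge ?psi_elen ?ler_pM2l//= psi_ends.
    have h : 0 < t < elen e by rewrite t0'.
    by rewrite (ept_inner h).
  rewrite tropE kaff; last first.
    by rewrite psi_elen mulr_ge0 ?(ltW r0)//= ler_pM2l.
  by rewrite psi_ends /=; ring.
Qed.

End Cover.

Section MaximumOfEdgewiseAffine.
Variables (R : realType) (G : tcurve R) (I : finType).
Variables (lam : I -> gpoint G -> R) (k : I -> edge G -> R).
Hypothesis lam_affine : forall i e t, 0 <= t <= elen e ->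
  lam i (ept e t) = lam i (vpt (ends e false)) + k i e * t.

Let M (y : gpoint G) : R := \big[Num.max/0]_i lam i y.
Let lam_le i y : lam i y <= M y. Proof. exact: le_bigmax. Qed.

Lemma bigmax_attained y : 0 < M y -> exists i, lam i y = M y.
Proof.
move=> y0; apply: contrapT => /forallNP none.
suff : M y < M y by rewrite ltxx.
apply: bigmax_lt => // i _; rewrite lt_neqAle lam_le andbT; apply/eqP.
exact: none.
Qed.

Lemma positive_component_vertex x : 0 < M x ->
  exists v, connected_component [set y | 0 < M y] x (vpt v).
Proof.
case: x => [v|[[e t] /= h]] hx; first by exists v; exact: connected_component_refl.
rewrite -(ept_inner h) in hx *.
have [i hi] := bigmax_attained hx.
have pos u : 0 <= u <= elen e -> 0 < lam i (vpt (ends e false)) + k i e * u ->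
    0 < M (ept e u).
  by move=> hu hp; apply: lt_le_trans (lam_le i _); rewrite lam_affine.
case/andP: h => t0 tL.
have post : 0 < lam i (vpt (ends e false)) + k i e * t.
  by rewrite -lam_affine ?hi// !ltW.
have [k0|k0] := leP 0 (k i e).
  exists (ends e true); rewrite -(ept_ge (lexx (elen e))).
  apply: (@component_segment _ _ _ _ e t (elen e) t).
  - move=> u /andP[tu uL]; apply: pos; first by rewrite uL (le_trans _ tu)// ltW.
    by nra.
  - by rewrite lexx ltW.
  - exact: connected_component_refl.
  - by rewrite lexx ltW.
exists (ends e false); rewrite -(ept_le0 e (lexx 0)).
apply: (@component_segment _ _ _ _ e 0 t t).
- move=> u /andP[u0 ut]; apply: pos; first by rewrite u0 (le_trans ut)// ltW.
  by nra.
- by rewrite lexx ltW.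
- exact: connected_component_refl.
- by rewrite lexx ltW.
Qed.

Lemma component_edge_bound x (i : vert G -> I) (e : edge G) :
    let Om := connected_component [set y | 0 < M y] x in
    (forall v, Om (vpt v) -> lam (i v) (vpt v) = M (vpt v)) ->
    (forall j, k j e \is a Num.int) ->
  \sum_(b : bool) `[< Om (vpt (ends e b)) >]%:R *
      (1 + (-1) ^+ b * k (i (ends e b)) e) <=
    (if e \in edges_in Om then 2 else 0 : R).
Proof.
move=> Om hi kint; have L0 := elen_gt0 e.
have eptb b : ept e (if b then elen e else 0) = vpt (ends e b).
  by case: b; [exact: ept_ge|exact: ept_le0].
have itvb (b : bool) : 0 <= (if b then elen e else 0) <= elen e.
  by case: b; rewrite lexx ?andbT ltW.
have aff1 j : lam j (vpt (ends e true)) = lam j (vpt (ends e false)) + k j e * elen e.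
  by rewrite -lam_affine ?ept_ge ?lexx ?(ltW L0).
case: ifPn => [|eN].
  rewrite inE => /asboolP eOm.
  have VE b : Om (vpt (ends e b)) by rewrite -eptb; exact: eOm.
  rewrite big_bool !asboolT//= expr1 expr0 !mul1r mulN1r.
  have := lam_le (i (ends e true)) (vpt (ends e false)).
  have := lam_le (i (ends e false)) (vpt (ends e true)).
  rewrite -!hi// !aff1; set kf := k _ e; set kt := k _ e => h1 h2.
  have : (kf - kt) * elen e <= 0 by lra.
  by rewrite pmulr_lle0//; lra.
apply: sumr_le0 => b _.
case: asboolP => [Omb|_]; last by rewrite mul0r.
rewrite mul1r.
have [t tI ltle0] : exists2 t, 0 <= t <= elen e & M (ept e t) <= 0.
  apply: contrapT => none; case/negP: eN; rewrite inE; apply/asboolP.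
  apply: (component_segment _ (itvb b)); last by rewrite eptb.
  move=> t tI; rewrite /= ltNge; apply/negP => h.
  by apply: none; exists t.
set j := i (ends e b).
have jpos : 0 < lam j (vpt (ends e b)) by rewrite hi//; exact: (connected_component_sub Omb).
have jt : lam j (ept e t) <= 0 by apply: le_trans ltle0.
rewrite lam_affine// in jt.
case/andP: tI => t0 tL.
have kneg : (-1) ^+ b * k j e < 0.
  case: (b) jpos => /=; rewrite ?aff1 ?expr1 ?expr0 => jpos; nra.
have sint : (-1) ^+ b * k j e \is a Num.int by rewrite rpredM ?rpred_sign.
have := norm_intr_ge1 sint; rewrite lt_eqF// ltr0_norm// => /(_ isT).
by rewrite -/j; lra.
Qed.

End MaximumOfEdgewiseAffine.

Theorem lemma3p17 (R : realType) (C : hyp_cover R)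
    (lam : vert (graphT C) -> gpoint (graphC C) -> R)
    (hlam : forall v0 : vert (graphT C), is_lambda v0 (lam v0))
    (x : gpoint (graphC C)) (hx : Delta_open lam x) :
  (0 < genus (connected_component (Delta_open lam) x))%N.
Proof.
set Om := connected_component _ x.
rewrite lt0n; apply/negP; rewrite addn_eq0 sum_nat_eq0.
move=> /andP[/eqP betti0 /forallP g0].
have /choice[q hq] : forall v0, exists q, tree_slopes v0 q /\
    forall e t, 0 <= t <= elen e -> lam v0 (ept e t) =
      lam v0 (vpt (ends e false)) + (ramord e)%:R * q (psiE e) * t.
  by move=> v0; have [q h1 h2] := is_lambda_slopes (hlam v0); exists q.
pose k v0 e : R := (ramord e)%:R * q v0 (psiE e).
have kint v0 e : k v0 e \is a Num.int by apply: tree_slopes_int; exact: (hq v0).1.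
have aff v0 e t : 0 <= t <= elen e ->
    lam v0 (ept e t) = lam v0 (vpt (ends e false)) + k v0 e * t.
  exact: (hq v0).2.
have [v0 v0Om] := positive_component_vertex aff hx.
have /choice[i hi] : forall v, exists v0,
    Om (vpt v) -> lam v0 (vpt v) = lambda_max lam (vpt v).
  move=> v.
  have [/connected_component_sub/bigmax_attained[v1]|nOm] := pselect (Om (vpt v)).
    by exists v1.
  by exists (psiV v) => /nOm.
pose V := [pred v | `[< Om (vpt v) >]].
pose s (d : dart (graphC C)) : R := 1 + (-1) ^+ d.2 * k (i (dorig d)) d.1.
have effective : 0 <= \sum_(v | V v) (- 2 + \sum_(d : dart (graphC C) | dorig d == v) s d).
  apply: sumr_ge0 => v vV.
  have gv : vgenus v = 0%N by apply/eqP; exact: implyP (g0 v) vV.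
  have := tree_slopes_effective v (hq (i v)).1.
  rewrite gv mulr0 sub0r -addrA; congr (0 <= _ + _).
  rewrite big_split /= sumr_const; congr (_ + _).
  by apply: eq_bigr => d /eqP ->.
have := forest_card betti0 v0Om.
have -> : #|[set v : vert (graphC C) | `[< Om (vpt v) >]]%SET| = #|V| by rewrite cardsE.
rewrite ltnNge => /negP; apply; rewrite -(ler_nat R).
move: effective; rewrite big_split /= (sum_darts V s) sumr_const => effective.
have : \sum_e \sum_(b : bool) (V (ends e b))%:R * s (e, b) <= 2 * #|edges_in Om|%:R.
  apply: (le_trans (ler_sum _ (fun e _ => component_edge_bound aff hi (kint^~ e)))).
  by rewrite -big_mkcond /= sumr_const mulr_natr.
move: effective; rewrite mulNrn -mulr_natr; lra.
Qed.
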